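(* Let $r\ge1$, $\mathbf n=(n_1,\dots,n_r)\in\mathbb N_0^r$, $\mathbf a,\mathbf b\in\mathbb R^{r+1}$, $\mathbf x\in\mathbb C^r$, such that no lower parameter of the ${}_3F_2$'s occurring below is a nonpositive integer. Then $$\begin{aligned}&\big(|\mathbf n^2|+|\mathbf a|\big)\;{}_rS_{\mathbf n}(\mathbf x;\mathbf a,\mathbf b)-\big(n_1+2|\mathbf n^2|+|\mathbf a|+|\mathbf b|-1\big)\;{}_rS_{\mathbf n}(\mathbf x;a_1+1,a_2,\dots,a_{r+1},b_1,\dots,b_{r+1})\\&\quad+\big(|\mathbf n|+|\mathbf b|-1\big)\;{}_rS_{\mathbf n}(\mathbf x;a_1+1,a_2,\dots,a_{r+1},b_1-1,b_2,\dots,b_{r+1})=0.\end{aligned}$$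
   Context: Notation: $(c)_k=c(c+1)\cdots(c+k-1)$, $(c)_0=1$; ${}_3F_2\left(\begin{matrix}c_1,c_2,c_3\\ d_1,d_2\end{matrix}\Big|z\right)=\sum_{k\ge0}\frac{(c_1)_k(c_2)_k(c_3)_k}{(d_1)_k(d_2)_k}\frac{z^k}{k!}$ (a finite sum when $c_1=-n$, $n\in\mathbb N_0=\{0,1,\dots\}$). For $r\ge1$, $\mathbf n=(n_1,\dots,n_r)$, $\mathbf a=(a_1,\dots,a_{r+1})$, $\mathbf b=(b_1,\dots,b_{r+1})$: $|\mathbf n^j|=n_j+\cdots+n_r$ with $|\mathbf n^{r+1}|=0$, $|\mathbf a^j|=a_j+\cdots+a_{r+1}$, $|\mathbf b^j|=b_j+\cdots+b_{r+1}$, and $|\mathbf n|=|\mathbf n^1|$, $|\mathbf a|=|\mathbf a^1|$, $|\mathbf b|=|\mathbf b^1|$. For $\mathbf x=(x_1,\dots,x_r)$, $${}_rS_{\mathbf n}(\mathbf x;\mathbf a,\mathbf b)=\prod_{j=1}^r\left\{\Big(|\mathbf a^{j+1}|+\frac{x_j}{2}\Big)_{|\mathbf n^{j+1}|}\;{}_3F_2\left(\begin{matrix}-n_j,\;n_j+2|\mathbf n^{j+1}|+|\mathbf a^j|+|\mathbf b^j|-1,\;|\mathbf n^{j+1}|+|\mathbf a^{j+1}|+\frac{x_j}{2}\\ 2|\mathbf n^{j+1}|+|\mathbf a^{j+1}|+|\mathbf b^{j+1}|,\;|\mathbf n^{j+1}|+|\mathbf a^j|\end{matrix}\,\Big|\,1\right)\right\}.$$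 *)

(* Defs.v *)
From mathcomp Require Export all_boot all_order all_algebra.
From mathcomp Require Export all_classical all_reals all_analysis.
From mathcomp Require Export complex.
Export Order.TTheory GRing.Theory Num.Theory numFieldNormedType.Exports.
Set Implicit Arguments.
Unset Strict Implicit.
Unset Printing Implicit Defensive.

Local Open Scope ring_scope.
Local Open Scope complex_scope.

Definition poch (K : pzSemiRingType) (c : K) (k : nat) : K :=
  \prod_(i < k) (c + i%:R).

(* The denominator vanishes for large k if d1 or d2 is a nonpositive integer;
   the definition is meaningful only for lower parameters that are not. *)
Definition hyp3F2_term (K : fieldType) (c1 c2 c3 d1 d2 z : K) (k : nat) : K :=
  poch c1 k * poch c2 k * poch c3 k / (poch d1 k * poch d2 k)
  * (z ^+ k / k`!%:R).

Definition hyp3F2 (K : numFieldType) (c1 c2 c3 d1 d2 z : K) : K :=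
  limn (series (hyp3F2_term c1 c2 c3 d1 d2 z)).

(* Indices start from 0: the sum v_j + ... + v_m written |v^j| with indices
   from 1 is tail v (j - 1), and the empty sum |v^(m+1)| = 0 is tail v m. *)
Definition tail (V : nmodType) (m : nat) (v : 'rV[V]_m) (j : nat) : V :=
  \sum_(i < m | (j <= i)%N) v ord0 i.

Section S.
Variables (R : realType) (r : nat).
Implicit Types (n : 'rV[nat]_r) (x : 'rV[R[i]]_r) (a b : 'rV[R]_r.+1).

Definition lower1 n a b (j : 'I_r) : R :=
  (2 * tail n j.+1)%:R + tail a j.+1 + tail b j.+1.

Definition lower2 n a (j : 'I_r) : R :=
  (tail n j.+1)%:R + tail a j.

Definition multiS n x a b : R[i] :=
  \prod_(j < r)
    (poch ((tail a j.+1)%:C + x ord0 j / 2) (tail n j.+1)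
     * hyp3F2
         (- (n ord0 j)%:R)
         ((n ord0 j + 2 * tail n j.+1)%:R + tail a j + tail b j - 1)%:C
         ((tail n j.+1)%:R + (tail a j.+1)%:C + x ord0 j / 2)
         (lower1 n a b j)%:C
         (lower2 n a j)%:C
         1).

Definition nonpos_int (c : R) : Prop := exists m : nat, c = - m%:R.

Definition admissible n a b : Prop :=
  forall j : 'I_r, ~ nonpos_int (lower1 n a b j) /\ ~ nonpos_int (lower2 n a j).

End S.

(* Main.v *)
(** Only the first factor depends on [a_1] and [b_1]. Writing [s] for its
    second upper and [d] for its second lower parameter, the claim becomes the
    contiguous relation [d F(s; d) - s F(s+1; d+1) + (s - d) F(s; d+1) = 0],
    which holds term by term because [d / (d)_k = (d+k) / (d+1)_k] and
    [s (s+1)_k = (s+k) (s)_k]. *)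
Require Import Defs.
From mathcomp Require Import ring.

Set Implicit Arguments.
Unset Strict Implicit.
Unset Printing Implicit Defensive.

Local Open Scope ring_scope.
Local Open Scope complex_scope.

(** Both sides are [poch c k.+1], with either the first or the last factor split off. *)
Lemma poch_shift (K : comPzRingType) (c : K) (k : nat) :
  c * poch (c + 1) k = poch c k * (c + k%:R).
Proof.
transitivity (poch c k.+1); last by rewrite /poch big_ord_recr.
rewrite /poch big_ord_recl addr0; congr (_ * _).
by apply: eq_bigr => i _; rewrite lift0 -addrA nat1r.
Qed.

Lemma poch_neq0 (K : idomainType) (c : K) (k : nat) :
  (forall i : nat, c + i%:R != 0) -> poch c k != 0.
Proof. by move=> c_neq0; apply/prodf_neq0 => i _. Qed.

Lemma poch_opp_nat (K : pzRingType) (m k : nat) :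
  (m < k)%N -> poch (- m%:R : K) k = 0.
Proof.
elim: k => // k IH; rewrite ltnS leq_eqVlt /poch big_ord_recr /=.
by case/predU1P=> [-> | /IH]; rewrite ?addNr ?mulr0 // /poch => ->; rewrite mul0r.
Qed.

(** For [k > m] the product [poch (- m%:R) k] contains the factor [- m%:R + m%:R], so the partial
    sums are constant from [m.+1] on and the limit is that constant. *)
Lemma hyp3F2_finite (K : numFieldType) (m : nat) (c2 c3 d1 d2 z : K) :
  hyp3F2 (- m%:R) c2 c3 d1 d2 z
  = \sum_(k < m.+1) hyp3F2_term (- m%:R) c2 c3 d1 d2 z k.
Proof.
apply: (@lim_near_cst K^o) => //; exists m.+1 => // p /= le_mp.
rewrite /series /= -(big_mkord xpredT) (big_cat_nat _ le_mp) //=.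
rewrite [X in _ + X]big_nat_cond [X in _ + X]big1 ?addr0 // => k.
by case/andP=> /andP[lt_mk _] _; rewrite /hyp3F2_term poch_opp_nat // !mul0r.
Qed.

Lemma hyp3F2_contiguous (K : numFieldType) (m : nat) (s c d1 d z : K) :
  (forall i : nat, d + i%:R != 0) ->
  d * hyp3F2 (- m%:R) s c d1 d z
  - s * hyp3F2 (- m%:R) (s + 1) c d1 (d + 1) z
  + (s - d) * hyp3F2 (- m%:R) s c d1 (d + 1) z = 0.
Proof.
move=> d_neq0; rewrite !hyp3F2_finite !mulr_sumr -sumrB -big_split big1 //= => k _.
have d1_neq0 : poch (d + 1) k != 0.
  by apply: poch_neq0 => i; rewrite -addrA nat1r.
have d_inv : d / poch d k = (d + k%:R) / poch (d + 1) k.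
  by apply/eqP; rewrite eqr_div ?d1_neq0 ?poch_neq0 // poch_shift mulrC.
rewrite /hyp3F2_term !invfM.
set u := poch (- m%:R) k; set v := poch c k; set w := (poch d1 k)^-1.
set t := z ^+ k / _.
(* With the common factors pulled out, both shifts become linear factors, and the bracket vanishes
   because [(d + k) - (s + k) + (s - d) = 0]. *)
transitivity (u * v * w * t * (poch s k * (d / poch d k)
  - (s * poch (s + 1) k) / poch (d + 1) k + (s - d) * poch s k / poch (d + 1) k)).
  by ring.
by rewrite d_inv poch_shift; ring.
Qed.

Lemma tailD (V : nmodType) (m : nat) (u v : 'rV[V]_m) (j : nat) :
  tail (u + v) j = tail u j + tail v j.
Proof. by rewrite /tail -big_split; apply: eq_bigr => i _; rewrite mxE. Qed.

Lemma tailN (V : zmodType) (m : nat) (v : 'rV[V]_m) (j : nat) :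
  tail (- v) j = - tail v j.
Proof. by rewrite /tail -sumrN; apply: eq_bigr => i _; rewrite mxE. Qed.

(** Hence changing the first entry of a vector affects its [tail] at 0 only. *)
Lemma tail_delta0 (K : pzSemiRingType) (m : nat) (j : nat) :
  tail (delta_mx ord0 ord0 : 'rV[K]_m.+1) j = (j == 0)%:R.
Proof.
rewrite /tail big_mkcond big_ord_recl big1 => [|i _]; last by rewrite mxE if_same.
by rewrite /= addr0 mxE leqn0; case: eqP.
Qed.

Lemma tail0 (V : nmodType) (m : nat) (v : 'rV[V]_m) (hm : (0 < m)%N) :
  tail v 0 = v ord0 (Ordinal hm) + tail v 1.
Proof.
rewrite /tail (bigD1 (Ordinal hm)) //=; congr (_ + _).
by apply: eq_bigl => i; rewrite -val_eqE /= lt0n.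
Qed.

(** [P] is chosen before [a'] and [b'], so one and the same factor can be taken out of all three
    terms of the relation. *)
Lemma multiS_head (R : realType) (r : nat) (hr : (0 < r)%N)
    (n : 'rV[nat]_r) (x : 'rV[R[i]]_r) (a b : 'rV[R]_r.+1) :
  exists P : R[i], forall a' b' : 'rV[R]_r.+1,
    (forall j : nat, tail a' j.+1 = tail a j.+1) ->
    (forall j : nat, tail b' j.+1 = tail b j.+1) ->
    multiS n x a' b' =
    P * hyp3F2 (- (n ord0 (Ordinal hr))%:R)
          ((n ord0 (Ordinal hr) + 2 * tail n 1)%:R + tail a' 0 + tail b' 0 - 1)%:C
          ((tail n 1)%:R + (tail a 1)%:C + x ord0 (Ordinal hr) / 2)
          ((2 * tail n 1)%:R + tail a 1 + tail b 1)%:C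
          ((tail n 1)%:R + tail a' 0)%:C 1.
Proof.
pose f (u v : 'rV[R]_r.+1) (j : 'I_r) :=
  poch ((tail u j.+1)%:C + x ord0 j / 2) (tail n j.+1)
  * hyp3F2 (- (n ord0 j)%:R)
      ((n ord0 j + 2 * tail n j.+1)%:R + tail u j + tail v j - 1)%:C
      ((tail n j.+1)%:R + (tail u j.+1)%:C + x ord0 j / 2)
      (lower1 n u v j)%:C (lower2 n u j)%:C 1.
have multiSE u v : multiS n x u v
    = f u v (Ordinal hr) * \prod_(j | j != Ordinal hr) f u v j.
  exact: (@bigD1 _ _ _ _ (Ordinal hr) xpredT (f u v)).
have f_tail a' b' i : (forall j : nat, tail a' j.+1 = tail a j.+1) ->
    (forall j : nat, tail b' j.+1 = tail b j.+1) ->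
    i != Ordinal hr -> f a' b' i = f a b i.
  (* Since [i] is a successor, [tail _ i] also falls under the hypotheses on successor indices. *)
  move=> aa' bb'; rewrite -val_eqE /= -lt0n => /prednK i_gt0.
  by rewrite /f /lower1 /lower2 -i_gt0 !aa' !bb'.
exists (poch ((tail a 1)%:C + x ord0 (Ordinal hr) / 2) (tail n 1)
  * \prod_(j | j != Ordinal hr) f a b j) => a' b' aa' bb'.
transitivity (f a' b' (Ordinal hr) * \prod_(j | j != Ordinal hr) f a b j).
  rewrite multiSE; apply: (congr1 ( *%R _)); apply: eq_bigr => i.
  exact: f_tail.
rewrite [RHS]mulrAC; apply: (congr1 ( *%R^~ _)).
by rewrite /f /lower1 /lower2 /= aa' bb'.
Qed.

Theorem theorem5p19 (R : realType) (r : nat) (hr : (0 < r)%N)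
    (n : 'rV[nat]_r) (a b : 'rV[R]_r.+1) (x : 'rV[R[i]]_r) :
  let e1 : 'rV[R]_r.+1 := delta_mx ord0 ord0 in
  admissible n a b ->
  admissible n (a + e1) b ->
  admissible n (a + e1) (b - e1) ->
  ((tail n 1)%:R + tail a 0)%:C * multiS n x a b
  - ((n ord0 (Ordinal hr) + 2 * tail n 1)%:R + tail a 0 + tail b 0 - 1)%:C
    * multiS n x (a + e1) b
  + ((tail n 0)%:R + tail b 0 - 1)%:C * multiS n x (a + e1) (b - e1) = 0.
Proof.
move=> e1 adm _ _.
have [_ d_ok] := adm (Ordinal hr).
have aS j : tail (a + e1) j.+1 = tail a j.+1 by rewrite tailD tail_delta0 addr0.
have bS j : tail (b - e1) j.+1 = tail b j.+1.
  by rewrite tailD tailN tail_delta0 subr0.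
have a0 : tail (a + e1) 0 = tail a 0 + 1 by rewrite tailD tail_delta0.
have b0 : tail (b - e1) 0 = tail b 0 - 1 by rewrite tailD tailN tail_delta0.
(* With the shifted vectors opaque, failed unifications do not unfold matrix
   operations. *)
move: (a + e1) (b - e1) aS bS a0 b0 => a' b' aS bS a0 b0.
have [P multiSE] := multiS_head hr n x a b.
pose s := (n ord0 (Ordinal hr) + 2 * tail n 1)%:R + tail a 0 + tail b 0 - 1.
pose d := (tail n 1)%:R + tail a 0.
(* [d] is [lower2] at the first index; a zero here would make it the nonpositive integer
   [- i%:R]. *)
have d_neq0 i : d%:C + i%:R != 0 :> R[i].
  rewrite -(rmorph_nat (real_complex R)) -rmorphD fmorph_eq0.
  by apply/eqP => /addr0_eq di; apply: d_ok; exists i; rewrite -di opprK.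
pose F u v : R[i] := hyp3F2 (- (n ord0 (Ordinal hr))%:R) u
  ((tail n 1)%:R + (tail a 1)%:C + x ord0 (Ordinal hr) / 2)
  ((2 * tail n 1)%:R + tail a 1 + tail b 1)%:C v 1.
(* Raising the first entry of [a] moves [s] to [s + 1]; lowering that of [b] as well restores [s].
   The parameter [d] sees only [a]. *)
have s_shift : (n ord0 (Ordinal hr) + 2 * tail n 1)%:R + (tail a 0 + 1)
  + tail b 0 - 1 = s + 1 by rewrite /s; ring.
have s_fixed : (n ord0 (Ordinal hr) + 2 * tail n 1)%:R + (tail a 0 + 1)
  + (tail b 0 - 1) - 1 = s by rewrite /s; ring.
have d_shift : (tail n 1)%:R + (tail a 0 + 1) = d + 1 by rewrite /d addrA.
(* The third coefficient is the one of the contiguous relation: subtracting [d] removes [tail a 0]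
   and one of the two copies of [tail n 1]. *)
have sd : (tail n 0)%:R + tail b 0 - 1 = s - d.
  have -> : tail n 0 = (n ord0 (Ordinal hr) + tail n 1)%N by exact: tail0.
  by rewrite /s /d 2!natrD (natrM _ 2); ring.
have M1 : multiS n x a b = P * F s%:C d%:C by exact: multiSE.
have M2 : multiS n x a' b = P * F (s + 1)%:C (d + 1)%:C.
  rewrite (multiSE _ _ aS (fun=> erefl)) a0 s_shift d_shift; reflexivity.
have M3 : multiS n x a' b' = P * F s%:C (d + 1)%:C.
  rewrite (multiSE _ _ aS bS) a0 b0 s_fixed d_shift; reflexivity.
have rel : d%:C * F s%:C d%:C - s%:C * F (s + 1)%:C (d + 1)%:C
  + (s - d)%:C * F s%:C (d + 1)%:C = 0.
  have addC1 u : (u + 1)%:C = u%:C + 1 :> R[i] by exact: (rmorphD (real_complex R) u 1).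
  have -> : (s - d)%:C = s%:C - d%:C by exact: (rmorphB (real_complex R) s d).
  rewrite !addC1; exact: hyp3F2_contiguous.
have combine (m1 m2 m3 f1 f2 f3 u v w : R[i]) :
    m1 = P * f1 -> m2 = P * f2 -> m3 = P * f3 ->
    u * f1 - v * f2 + w * f3 = 0 -> u * m1 - v * m2 + w * m3 = 0.
  by move=> -> -> -> f_rel; rewrite -[RHS](mulr0 P) -f_rel; ring.
by rewrite sd; apply: (combine _ _ _ _ _ _ _ _ _ M1 M2 M3 rel).
Qed.
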